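(* Let $V$ be a Hilbert space and let $X\subset V$ be a dense subspace. Let $A:X\to V$ be a selfadjoint operator with domain $X$ whose eigenvectors $\{\varphi_j\}_{j=1}^\infty$ form a complete orthonormal basis of $V$, with $A\varphi_j=\lambda_j\varphi_j$ and $\lambda_1\le\lambda_2\le\cdots\le\lambda_k\le\cdots$. Then for every integer $k\ge1$, $$\lambda_k=\min_{W\in\mathcal W_k}\ \sup_{v\in W,\ v\ne0}\frac{(Av,v)}{(v,v)},$$ where $\mathcal W_k$ is the set of all linear subspaces $W\subset X$ with $\dim W=k$.
   Context: $(\cdot,\cdot)$ denotes the inner product of $V$. *)

(* Defs.v *)
From HB Require Import structures.
From mathcomp Require Import all_boot all_order all_algebra.
From mathcomp Require Import complex.
From mathcomp Require Import all_classical all_reals all_analysis.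
Set Implicit Arguments.
Unset Strict Implicit.
Unset Printing Implicit Defensive.
Import Order.TTheory GRing.Theory Num.Theory.
Import numFieldNormedType.Exports.
Local Open Scope classical_set_scope.
Local Open Scope ring_scope.

(* A Hilbert space may be real or complex: [scalars R s] is R or R[i]. *)
Variant scalar_kind := RealScalars | ComplexScalars.

Definition scalars (R : realType) (s : scalar_kind) : numFieldType :=
  match s with RealScalars => R | ComplexScalars => R[i] end.

Definition of_real (R : realType) (s : scalar_kind) : R -> scalars R s :=
  match s with
  | RealScalars => fun x => x
  | ComplexScalars => fun x => Complex x 0
  end.

Definition real_part (R : realType) (s : scalar_kind) : scalars R s -> R :=
  match s with
  | RealScalars => fun z => z
  | ComplexScalars => fun z => complex.Re z
  end.

Definition conj_scalar (R : realType) (s : scalar_kind) :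
    scalars R s -> scalars R s :=
  match s with
  | RealScalars => fun z => z
  | ComplexScalars => fun z => conjc z
  end.

Section HilbertSpace.
Context (R : realType) (s : scalar_kind).
Local Notation K := (scalars R s).
Context (V : completeNormedModType K).

(* [{dot V for conj_scalar}] is a positive definite Hermitian form, linear in
   its first argument.  A complete normed space whose norm comes from such a
   form is a Hilbert space. *)
Definition norm_from_inner (ip : {dot V for @conj_scalar R s}) : Prop :=
  forall v : V, `|v| ^+ 2 = ip v v.

Definition orthonormal_basis (ip : {dot V for @conj_scalar R s})
    (e : nat -> V) : Prop :=
  (forall i j, ip (e i) (e j) = (i == j)%:R) /\
  (forall v : V, series (fun j => ip v (e j) *: e j) @ \oo --> v).

(* Unbounded operators: the domain is a linear subspace of V, given as a
   [subLmodType], whose inclusion into V is [val]. *)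
Section Operator.
Context (ip : {dot V for @conj_scalar R s}).
Context (P : {pred V}) (X : subLmodType P) (A : {linear X -> V}).

Definition operator_graph : set (V * V) := [set (val x, A x) | x in [set: X]].

(* The graph of the adjoint A^*: w is in its domain, with A^* w = z, when
   (A v, w) = (v, z) for all v in X. *)
Definition adjoint_graph : set (V * V) :=
  [set wz | forall v : X, ip (A v) wz.1 = ip (val v) wz.2].

Definition selfadjoint : Prop := adjoint_graph = operator_graph.

(* For symmetric A the quotient (A v, v) / (v, v) is a real number; taking the
   real part only moves it from the scalar field to R. *)
Definition rayleigh (v : X) : R :=
  real_part (ip (A v) (val v) / ip (val v) (val v)).

Definition rayleigh_sup (W : set X) : \bar R :=
  ereal_sup [set (rayleigh v)%:E | v in [set v : X | W v /\ v != 0]].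

End Operator.

End HilbertSpace.

Section Subspaces.
Context (K : numFieldType) (E : lmodType K).

Definition linear_subspace (W : set E) : Prop :=
  W 0 /\ forall (a : K) (u v : E), W u -> W v -> W (a *: u + v).

Definition linearly_independent (k : nat) (e : 'I_k -> E) : Prop :=
  forall c : 'I_k -> K, \sum_(i < k) c i *: e i = 0 -> forall i, c i = 0.

Definition spans (k : nat) (e : 'I_k -> E) (W : set E) : Prop :=
  W = [set \sum_(i < k) c i *: e i | c in [set: 'I_k -> K]].

Definition has_dim (W : set E) (k : nat) : Prop :=
  exists e : 'I_k -> E, linearly_independent e /\ spans e W.

Definition subspaces_of_dim (k : nat) : set (set E) :=
  [set W | linear_subspace W /\ has_dim W k].

End Subspaces.

Definition is_min (R : realType) (S : set (\bar R)) (m : \bar R) : Prop :=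
  S m /\ lbound S m.

(* Main.v *)
Require Import Defs.
From HB Require Import structures.
From mathcomp Require Import all_boot all_order all_algebra.
From mathcomp Require Import complex.
From mathcomp Require Import all_classical all_reals all_analysis.
Set Implicit Arguments.
Unset Strict Implicit.
Unset Printing Implicit Defensive.
Import Order.TTheory GRing.Theory Num.Theory.
Import numFieldNormedType.Exports.
Local Open Scope classical_set_scope.
Local Open Scope ring_scope.

(* The span of the first k eigenvectors has Rayleigh quotients at most
   lambda_k, with equality at phi_k.  Conversely a k-dimensional W contains
   some v <> 0 orthogonal to phi_1, ..., phi_(k-1); by symmetry of A the
   partial sums S_n of the eigenbasis expansion of A v - lambda_k v satisfy
   (S_n, v) = sum_(j <= n) (lambda_j - lambda_k) |(v, phi_j)|^2 >= 0, hence
   (A v, v) >= lambda_k (v, v) in the limit. *)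

(** * Conjugation and order, uniformly over real and complex scalars *)

Section Scalars.
Context (R : realType) (s : scalar_kind).
Implicit Types (x y : R) (z : scalars R s).

Lemma mul_conj_scalar_ge0 z : 0 <= z * conj_scalar z.
Proof.
case: s z => z; first by rewrite /= -expr2 sqr_ge0.
exact: (mul_conjC_ge0 (z : R[i])).
Qed.

Lemma conj_scalar_real x : conj_scalar (of_real s x) = of_real s x.
Proof. by case: s => //=; rewrite oppr0. Qed.

(** In [R[i]] the relation [0 <= z] includes the vanishing of the imaginary part. *)
Lemma conj_scalar_nneg z : 0 <= z -> conj_scalar z = z.
Proof.
case: s z => // z z0; have : (0 : R[i]) <= z := z0.
by case: z {z0} => a b; rewrite lecE /= => /andP[/eqP-> _]; rewrite oppr0.
Qed.

Lemma addr_conj_scalar_real z : z + conj_scalar z \is Num.real.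
Proof.
case: s z => z; first exact: num_real.
case: z => a b /=; apply/complex_realP; exists (a + a).
by transitivity (Complex (a + a) (b - b)); last by rewrite subrr.
Qed.

Lemma ler_of_real x y : (of_real s x <= of_real s y) = (x <= y).
Proof. by case: s => //=; exact: lecR. Qed.

Lemma of_real0 : of_real s 0 = 0 :> scalars R s.
Proof. by case: s. Qed.

Lemma of_realB x y : of_real s (x - y) = of_real s x - of_real s y.
Proof. by case: s => //=; apply: (rmorphB (real_complex R)). Qed.

Lemma of_realK : cancel (@of_real R s) (@real_part R s).
Proof. by case: s. Qed.

Lemma ler_real_part (z w : scalars R s) : z <= w -> real_part z <= real_part w.
Proof.
case: s z w => // z w zw; have : (z : R[i]) <= w := zw.
by rewrite lecE => /andP[].
Qed.

End Scalars.

(** The rank is at most [n], so the [m] rows are dependent. This will produce a nonzero vector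
    orthogonal to fewer eigenvectors than the dimension of the subspace. *)
Lemma exists_kernel_combination (K : fieldType) (m n : nat) (M : 'M[K]_(m, n)) :
  (n < m)%N -> exists2 u : 'rV_m, u != 0 & u *m M = 0.
Proof.
move=> nm; have: kermx M != 0.
  rewrite kermx_eq0 /row_free; apply/eqP => rM.
  by have := rank_leq_col M; rewrite rM leqNgt nm.
by case/rowV0Pn => u /sub_kermxP uM u0; exists u.
Qed.

(** * Inner product calculus and positivity through basis expansions *)

Section Hilbert.
Context (R : realType) (s : scalar_kind).
Local Notation K := (scalars R s).
Context (V : completeNormedModType K) (ip : {dot V for @conj_scalar R s}).
Implicit Types u v w : V.

Lemma ip_conj u v : ip u v = conj_scalar (ip v u).
Proof. by rewrite hermitian_subproof expr0 mul1r. Qed.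

Lemma ipZl a u v : ip (a *: u) v = a * ip u v.
Proof. exact: linearZl_LR. Qed.

Lemma ipZr a u v : ip u (a *: v) = conj_scalar a * ip u v.
Proof. exact: linearZr_LR. Qed.

Lemma ip0l v : ip 0 v = 0. Proof. exact: linear0l. Qed.

Lemma ipDl v u w : ip (u + w) v = ip u v + ip w v.
Proof. exact: linearDl. Qed.

Lemma ipDr u v w : ip u (v + w) = ip u v + ip u w.
Proof. exact: linearDr. Qed.

Lemma ipBl v u w : ip (u - w) v = ip u v - ip w v.
Proof. exact: linearBl. Qed.

Lemma ipBr u v w : ip u (v - w) = ip u v - ip u w.
Proof. exact: linearBr. Qed.

Lemma ip_suml v (I : Type) (r : seq I) (Q : pred I) (F : I -> V) :
  ip (\sum_(i <- r | Q i) F i) v = \sum_(i <- r | Q i) ip (F i) v.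
Proof. exact: linear_sumlz. Qed.

Lemma ip_sumr u (I : Type) (r : seq I) (Q : pred I) (F : I -> V) :
  ip u (\sum_(i <- r | Q i) F i) = \sum_(i <- r | Q i) ip u (F i).
Proof. exact: linear_sumr. Qed.

Lemma ip_gt0 v : v != 0 -> 0 < ip v v.
Proof. exact: neq0_dnorm_gt0. Qed.

Lemma ip_sum_swap_real u v : ip u v + ip v u \is Num.real.
Proof. by rewrite (ip_conj v u) addr_conj_scalar_real. Qed.

Hypothesis hilbert : norm_from_inner ip.

(* A weak Cauchy-Schwarz inequality, obtained by expanding
   [(|u| - |v|)^2 <= |u + v|^2]; it replaces the continuity of [ip]. *)
Lemma ip_sum_swap_ge u v : - (2 * (`|u| * `|v|)) <= ip u v + ip v u.
Proof.
have: (`|u| - `|v|) ^+ 2 <= `|u + v| ^+ 2.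
  rewrite -real_normK ?rpredB ?normr_real//.
  rewrite lerXn2r ?nnegrE// -[v in X in _ <= X]opprK -(normrN v).
  exact: ler_dist_dist.
rewrite hilbert ipDl !ipDr -!hilbert sqrrB -mulr_natl.
set a := _ ^+ 2; set b := _ ^+ 2; set t := 2 * _.
by rewrite addrAC [_ - t]addrC [a + ip _ _]addrC [ip _ _ + a + _]addrACA lerD2r.
Qed.

Section Basis.
Context (e : nat -> V) (e_basis : orthonormal_basis ip e).

(** The sum is twice the real part of [ip u v]. A partial sum [S] of the expansion of [u]
    contributes a nonnegative amount, and the remainder [u - S] at least [- 2 |u - S| |v|], which is
    arbitrarily close to 0. *)
Lemma ip_sum_swap_ge0 u v :
  (forall j, 0 <= ip u (e j) * ip (e j) v) -> 0 <= ip u v + ip v u.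
Proof.
move=> h; set d := _ + _.
(* The order on complex scalars is partial; this case split is available because [d] is real. *)
have [//|dlt0] := real_ge0P (ip_sum_swap_real u v).
have v1 : 0 < 2 * (`|v| + 1) by rewrite mulr_gt0// ltr_wpDl.
(* Chosen so that [|u - S|] below it gives [2 |u - S| |v| < - d]; the added 1 keeps the divisor
   positive when [v = 0]. *)
have eps : 0 < - d / (2 * (`|v| + 1)) by rewrite divr_gt0// oppr_gt0.
have /cvgrPdist_lt /(_ _ eps) [n _ /(_ n (leqnn n))] := e_basis.2 u.
rewrite /= /series /=; set S := \sum_(_ <= _ < _) _ => near.
have Sv : 0 <= ip S v.
  rewrite ip_suml; apply: sumr_ge0 => j _.
  by rewrite ipZl.
have vS : ip v S = ip S v by rewrite ip_conj conj_scalar_nneg.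
have dE : d = (ip S v + ip v S) + (ip (u - S) v + ip v (u - S)).
  by rewrite addrACA -ipDl -ipDr [S + _]addrC subrK.
have d_ge : - (2 * (`|u - S| * `|v|)) <= d.
  by rewrite dE -[X in X <= _]add0r lerD ?ip_sum_swap_ge// vS addr_ge0.
suff d_lt : d < - (2 * (`|u - S| * `|v|)).
  by have := le_lt_trans d_ge d_lt; rewrite ltxx.
rewrite ltrNr; apply: (@le_lt_trans _ _ (`|u - S| * (2 * (`|v| + 1)))).
  by rewrite mulrCA ler_wpM2l// ler_wpM2l// lerDl.
by rewrite -ltr_pdivlMr.
Qed.

End Basis.

(** * Rayleigh quotients and the eigenbasis *)

Section Eigen.
Context (P : {pred V}) (X : subLmodType P) (A : {linear X -> V}).
Hypothesis A_selfadjoint : selfadjoint ip A.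
Context (phi : nat -> X) (lam : nat -> R).
Hypothesis phi_basis : orthonormal_basis ip (fun j => val (phi j)).
Hypothesis phi_eigen : forall j, A (phi j) = of_real s (lam j) *: val (phi j).
Hypothesis lam_nondecreasing : nondecreasing_seq lam.

Lemma selfadjoint_sym (v w : X) : ip (A v) (val w) = ip (val v) (A w).
Proof.
have : operator_graph A (val w, A w) by exists w.
by rewrite -A_selfadjoint => /(_ v).
Qed.

Lemma ip_operator_ge (m : nat) (v : X) :
  (forall j, (j < m)%N -> ip (val v) (val (phi j)) = 0) ->
  of_real s (lam m) * ip (val v) (val v) <= ip (A v) (val v).
Proof.
move=> v_orth; set c := of_real s (lam m).
(* Symmetry moves [A] onto the eigenvector, where it acts as the real scalar [lam j]. *)
have coef j : ip (A v - c *: val v) (val (phi j)) =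
    of_real s (lam j - lam m) * ip (val v) (val (phi j)).
  rewrite ipBl selfadjoint_sym phi_eigen ipZr conj_scalar_real ipZl.
  by rewrite of_realB mulrBl.
have : 0 <= ip (A v - c *: val v) (val v) + ip (val v) (A v - c *: val v).
  apply: (ip_sum_swap_ge0 phi_basis) => j; rewrite coef (ip_conj (val (phi j))).
  have [jm|mj] := ltnP j m; first by rewrite v_orth// mulr0 mul0r.
  rewrite -mulrA mulr_ge0 ?mul_conj_scalar_ge0// -(of_real0 R s) ler_of_real.
  by rewrite subr_ge0 lam_nondecreasing.
(* By symmetry of [A] both summands are equal, so the sum is twice the desired difference. *)
rewrite ipBl ipBr ipZl ipZr conj_scalar_real -selfadjoint_sym -mulr2n.
by rewrite pmulrn_lge0// subr_ge0.
Qed.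

Lemma linearly_independent_eigen (k : nat) :
  linearly_independent (fun i : 'I_k => phi i).
Proof.
move=> c c0 i; have : ip (val (\sum_(i < k) c i *: phi i)) (val (phi i)) = 0.
  by rewrite c0 raddf0 ip0l.
rewrite raddf_sum ip_suml (bigD1 i)//= linearZ/= ipZl phi_basis.1 eqxx mulr1.
rewrite big1 ?addr0// => j ji; rewrite linearZ/= ipZl phi_basis.1.
by rewrite -val_eqE/= in ji; rewrite (negPf ji) mulr0.
Qed.

(** By orthonormality the two sides are the sums of [lam j * |c j|^2] and [lam m * |c j|^2] over
    [j <= m], compared term by term. *)
Lemma ip_operator_combination_le (m : nat) (c : 'I_m.+1 -> K) :
  let v := \sum_(i < m.+1) c i *: phi i in
  ip (A v) (val v) <= of_real s (lam m) * ip (val v) (val v).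
Proof.
move=> /=; set v := \sum_(_ < _) _.
have valv : val v = \sum_i c i *: val (phi (nat_of_ord i)).
  by rewrite raddf_sum; apply: eq_bigr => i _; rewrite /= linearZ.
have Av : A v = \sum_i c i *: A (phi (nat_of_ord i)).
  by rewrite raddf_sum; apply: eq_bigr => i _; rewrite /= linearZ.
have vE j : ip (val (phi (nat_of_ord j))) (val v) = conj_scalar (c j).
  rewrite valv ip_sumr (bigD1 j)//= ipZr phi_basis.1.
  rewrite eqxx mulr1 big1 ?addr0// => i ij; rewrite ipZr phi_basis.1.
  by rewrite -val_eqE/= eq_sym in ij; rewrite (negPf ij) mulr0.
rewrite Av ip_suml [X in _ * ip X _]valv ip_suml mulr_sumr.
apply: ler_sum => j _; rewrite phi_eigen !ipZl vE.
rewrite mulrCA ler_wpM2r ?mul_conj_scalar_ge0// ler_of_real.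
by rewrite lam_nondecreasing// -ltnS.
Qed.

Lemma ip_val_gt0 (v : X) : v != 0 -> 0 < ip (val v) (val v).
Proof.
by move=> v0; apply: ip_gt0; rewrite -(raddf0 (val : X -> V)) (inj_eq val_inj).
Qed.

Lemma rayleigh_ge (x : R) (v : X) : v != 0 ->
  of_real s x * ip (val v) (val v) <= ip (A v) (val v) -> x <= rayleigh ip A v.
Proof.
move=> v0 h; rewrite -[x](of_realK s); apply: ler_real_part.
by rewrite ler_pdivlMr// ip_val_gt0.
Qed.

Lemma rayleigh_le (x : R) (v : X) : v != 0 ->
  ip (A v) (val v) <= of_real s x * ip (val v) (val v) -> rayleigh ip A v <= x.
Proof.
move=> v0 h; rewrite -[x](of_realK s); apply: ler_real_part.
by rewrite ler_pdivrMr// ip_val_gt0.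
Qed.

Lemma rayleigh_sup_eigenspan (m : nat) :
  rayleigh_sup ip A
    [set \sum_(i < m.+1) c i *: phi i | c in [set: 'I_m.+1 -> K]] = (lam m)%:E.
Proof.
apply/eqP; rewrite eq_le; apply/andP; split.
  apply: ub_ereal_sup => _ [_ [[c _ <-] v0] <-]; rewrite lee_fin.
  exact/rayleigh_le/ip_operator_combination_le.
have phi1 : ip (val (phi m)) (val (phi m)) = 1 by rewrite phi_basis.1 eqxx.
have phi0 : phi m != 0.
  apply: contra_eq_neq phi1 => ->; rewrite raddf0 ip0l.
  by rewrite eq_sym oner_neq0.
apply: (@le_trans _ _ (rayleigh ip A (phi m))%:E).
  by rewrite lee_fin rayleigh_ge// phi_eigen ipZl.
apply: ereal_sup_ubound; exists (phi m) => //; split=> //.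
(* [phi m] is the last spanning vector: coefficient 1 at [ord_max], 0 elsewhere. *)
exists (fun i => (i == ord_max)%:R) => //.
rewrite (bigD1 ord_max)//= eqxx scale1r big1 ?addr0// => i /negPf ->.
by rewrite scale0r.
Qed.

Lemma rayleigh_sup_ge (m : nat) (W : set X) :
  has_dim W m.+1 -> ((lam m)%:E <= rayleigh_sup ip A W)%E.
Proof.
case=> e [e_free ->].
(* A row vector killed by [M] lists the coefficients of a combination of the [e i] orthogonal to the
   first [m] eigenvectors; one exists since [M] has [m.+1] rows and [m] columns. *)
pose M := \matrix_(i < m.+1, j < m) ip (val (e i)) (val (phi j)).
have [u u0 uM] := exists_kernel_combination M (ltnSn m).
set v := \sum_(i < m.+1) u 0 i *: e i.
have v0 : v != 0.
  apply: contra_neq u0 => /e_free u0; apply/rowP => i.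
  by rewrite mxE u0.
have v_orth j : (j < m)%N -> ip (val v) (val (phi j)) = 0.
  move=> jm; have /matrixP/(_ 0 (Ordinal jm)) := uM.
  rewrite !mxE => <-; rewrite raddf_sum ip_suml; apply: eq_bigr => i _.
  by rewrite /= linearZ ipZl mxE.
apply: (@le_trans _ _ (rayleigh ip A v)%:E).
  by rewrite lee_fin rayleigh_ge// ip_operator_ge.
by apply: ereal_sup_ubound; exists v => //; split=> //; exists (u 0).
Qed.

End Eigen.
End Hilbert.

Lemma linear_subspace_combinations (K : numFieldType) (E : lmodType K) (k : nat)
    (e : 'I_k -> E) :
  linear_subspace [set \sum_(i < k) c i *: e i | c in [set: 'I_k -> K]].
Proof.
split.
  exists (fun=> 0) => //.
  by rewrite big1// => i _; rewrite scale0r.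
move=> a _ _ [c _ <-] [d _ <-]; exists (fun i => a * c i + d i) => //.
rewrite scaler_sumr -big_split/=; apply: eq_bigr => i _.
by rewrite scalerDl scalerA.
Qed.

(* phi and lam are indexed from 0: [phi j], [lam j] are the eigenvector and
   eigenvalue numbered j + 1 *)
Theorem theorem3p3 (R : realType) (s : scalar_kind)
    (V : completeNormedModType (scalars R s))
    (ip : {dot V for @conj_scalar R s})
    (hilbert : norm_from_inner ip)
    (P : {pred V}) (X : subLmodType P)
    (X_dense : dense (range (val : X -> V)))
    (A : {linear X -> V})
    (A_selfadjoint : selfadjoint ip A)
    (phi : nat -> X) (lam : nat -> R)
    (phi_basis : orthonormal_basis ip (fun j => val (phi j)))
    (phi_eigen : forall j, A (phi j) = of_real s (lam j) *: val (phi j))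
    (lam_sorted : forall j, lam j <= lam j.+1)
    (k : nat) (k_ge1 : (1 <= k)%N) :
  is_min [set rayleigh_sup ip A W | W in @subspaces_of_dim _ X k]
         (lam k.-1)%:E.
Proof.
case: k k_ge1 => // m _ /=.
have lam_nd : nondecreasing_seq lam by apply/nondecreasing_seqP.
split.
  (* The minimum is attained at the span of [phi 0], ..., [phi m], which unification supplies as the
     witness. *)
  eexists; last exact: (rayleigh_sup_eigenspan phi_basis phi_eigen lam_nd).
  split; first exact: linear_subspace_combinations.
  exists (fun i => phi i); split=> //.
  exact: linearly_independent_eigen phi_basis _.
move=> _ [W [_ W_dim] <-].
exact: (rayleigh_sup_ge hilbert A_selfadjoint phi_basis phi_eigen lam_nd).
Qed.
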